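(* Let $\Omega\subset\mathbb{R}^m$ be a bounded domain with $C^2$ boundary, $n\ge1$, $G=\overline{\Omega}^n$, $T>0$, $X^\circ=\{x_i^\circ\}_{i=1}^n\in G$, and $F_i\in C([0,T]\times G;\mathbb{R}^m)$ for $i=1,\dots,n$. Let $X(t)=\{x_i(t)\}_{i=1}^n$ $(0\le t\le T)$ be a mild solution of $\dot{x}_i(t)=H_i(t,X(t))$ $(0<t<T)$, $x_i(0)=x_i^\circ$, $i=1,\dots,n$, and write $F_i(t):=F_i(t,X(t))$. If $x_i(t_0)\in\partial\Omega$ at some $t_0\in(0,T]$, then $$F_i(t_0)\cdot\nu(x_i(t_0))\ge0.$$ Moreover, if in addition there exists $\delta>0$ with $t_0+\delta\le T$ such that $x_i(t)\in\Omega$ for all $t_0<t<t_0+\delta$, then $$\frac{d^+}{dt}x_i(t_0):=\lim_{\tau\to+0}\frac{x_i(t_0+\tau)-x_i(t_0)}{\tau}=F_i(t_0)\quad\text{and}\quad F_i(t_0)\cdot\nu(x_i(t_0))=0.$$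
   Context: $\nu$ is the outward unit normal on $\partial\Omega$. Define $P:\overline{\Omega}\times\mathbb{R}^m\to\mathbb{R}^m$ by $P(x,f):=f-(f\cdot\nu(x))\nu(x)$ if $x\in\partial\Omega$ and $f\cdot\nu(x)>0$, and $P(x,f):=f$ otherwise. Define $H_i(t,X):=P(x_i,F_i(t,X))$ for $t\in[0,T]$, $X=\{x_i\}\in G$. Mild solution: $X(t)=\{x_i(t)\}_{i=1}^n$ is a mild solution if, for every $i=1,\dots,n$, $x_i\in C^0([0,T];\mathbb{R}^m)$, $x_i(t)\in\overline{\Omega}$, and $x_i(t)=x_i^\circ+\int_0^tH_i(s,X(s))\,ds$ for all $t\in[0,T)$. *)

(* Defs.v *)
From HB Require Import structures.
From mathcomp Require Import all_boot all_order all_algebra.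
From mathcomp Require Import all_classical all_reals all_analysis.

Set Implicit Arguments.
Unset Strict Implicit.
Unset Printing Implicit Defensive.

Import Order.TTheory GRing.Theory Num.Theory.
Import numFieldNormedType.Exports.

Local Open Scope classical_set_scope.
Local Open Scope ring_scope.

(* The norm of the library on ['rV[R]_m] is the sup norm: it is used only for
   the topology and for boundedness. The Euclidean structure comes from [dot]. *)
Definition dot (R : realType) (m : nat) (u v : 'rV[R]_m) : R :=
  \sum_(j < m) u 0 j * v 0 j.

Definition boundary (T : topologicalType) (A : set T) : set T :=
  closure A `\` interior A.

Definition C1_fun (R : realType) (V W : normedModType R) (f : V -> W) : Prop :=
  (forall x, differentiable f x) /\ (forall v, continuous ('D_v f)).

Definition C2_fun (R : realType) (V W : normedModType R) (f : V -> W) : Prop :=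
  (forall x, differentiable f x) /\ (forall v, C1_fun ('D_v f)).

Section Domain.
Context {R : realType} {m : nat}.
Implicit Types (Omega : set 'rV[R]_m.+1) (x v : 'rV[R]_m.+1)
  (Q : 'M[R]_m.+1) (gamma : 'rV[R]_m -> R).

(* Coordinates after the orthogonal change of variables y = x Q are split as
   y = (y', y_last), with y' = [col' ord_max y]. *)
Definition hd Q x : 'rV[R]_m := col' ord_max (x *m Q).
Definition lst Q x : R := (x *m Q) 0 ord_max.

(* Near x0, in orthonormal coordinates y = x Q, the set Omega is the part
   y_last > gamma y' lying above the graph of a C^2 function. *)
Definition C2_chart Omega x0 Q gamma : Prop :=
  [/\ Q *m Q^T = 1%:M,
      C2_fun gamma &
      \forall x \near x0, Omega x <-> gamma (hd Q x) < lst Q x].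

Definition C2_boundary Omega : Prop :=
  forall x0, boundary Omega x0 -> exists Q gamma, C2_chart Omega x0 Q gamma.

Definition bounded_domain Omega : Prop :=
  [/\ Omega !=set0, open Omega, connected Omega & bounded_set Omega].

(* v is a unit vector, orthogonal to the tangent space
   {w | (w Q)_last = D gamma (w Q)'} of the graph at x0, and points below the
   graph, that is, out of Omega. *)
Definition is_outward_unit_normal Omega x0 v : Prop :=
  exists Q gamma,
    [/\ C2_chart Omega x0 Q gamma,
        dot v v = 1,
        forall w, lst Q w = 'D_(hd Q w) gamma (hd Q x0) -> dot v w = 0 &
        lst Q v < 0].

(* The value is meaningful only at points of the boundary. *)
Definition outward_unit_normal Omega x : 'rV[R]_m.+1 :=
  get (is_outward_unit_normal Omega x).

Definition proj Omega x f : 'rV[R]_m.+1 :=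
  let nu := outward_unit_normal Omega x in
  if `[< boundary Omega x /\ 0 < dot f nu >] then f - dot f nu *: nu else f.

End Domain.

Section MildSolution.
Context {R : realType} {m n : nat}.
Implicit Types (Omega : set 'rV[R]_m.+1).

(* A point {x_i} of (R^m)^n is the matrix whose i-th row is x_i. *)
Definition conf_space Omega : set 'M[R]_(n, m.+1) :=
  [set X | forall i, closure Omega (row i X)].

Definition proj_field Omega (F : 'I_n -> R * 'M[R]_(n, m.+1) -> 'rV[R]_m.+1)
    (i : 'I_n) (t : R) (X : 'M[R]_(n, m.+1)) : 'rV[R]_m.+1 :=
  proj Omega (row i X) (F i (t, X)).

Definition vec_integral (a b : R) (f : R -> 'rV[R]_m.+1) : 'rV[R]_m.+1 :=
  \row_j (\int[lebesgue_measure]_(s in `[a, b]) (f s 0 j))%R.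

Definition mild_solution Omega (T : R) (X0 : 'M[R]_(n, m.+1))
    (F : 'I_n -> R * 'M[R]_(n, m.+1) -> 'rV[R]_m.+1)
    (X : R -> 'M[R]_(n, m.+1)) : Prop :=
  forall i : 'I_n,
    [/\ {within `[0, T], continuous (fun t => row i (X t))},
        forall t, 0 <= t <= T -> closure Omega (row i (X t)) &
        forall t, 0 <= t < T ->
          row i (X t) =
          row i X0 + vec_integral 0 t (fun s => proj_field Omega F i s (X s))].

End MildSolution.

(* Main.v *)
Require Import Defs.
From HB Require Import structures.
From mathcomp Require Import all_boot all_order all_algebra.
From mathcomp Require Import all_classical all_reals all_analysis.
From mathcomp Require Import lra.

Set Implicit Arguments.
Unset Strict Implicit.
Unset Printing Implicit Defensive.

Import Order.TTheory GRing.Theory Num.Theory.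
Import numFieldNormedType.Exports.

Local Open Scope classical_set_scope.
Local Open Scope ring_scope.

(** Let x be the i-th path, x0 = x(t0) a boundary point with outward normal nu,
    and F0 the force at time t0.  The whole proof rests on one observation
    ([inward_velocity]): a curve that starts at a boundary point, stays in the
    closure of Omega and has right derivative w there satisfies w.nu <= 0,
    since the height [gap] above the boundary vanishes at the starting point
    and is nonnegative along the curve, so that its right derivative, a
    negative multiple of w.nu, is nonnegative.

    First claim.  Suppose F0.nu < 0.  Then F0 points strictly into Omega, and
    by continuity so does the force at every boundary point x(s) with s close
    to t0; hence the projection is inactive for such s and the velocity field
    coincides with the continuous force near t0.  So t |-> x(t0 - t) has right
    derivative -F0 at 0 ([path_rderiv_left]).  This curve stays in the closure,
    so -F0.nu <= 0, a contradiction.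

    Second claim.  If x(t) lies in Omega for t slightly larger than t0, the
    projection is inactive there and x has right derivative F0 at t0
    ([path_rderiv_right]); as x stays in the closure, F0.nu <= 0, and the
    first claim gives equality.

    Two points need care.

    The sign of f.nu(x) at the boundary points x near x0 has to be read off the
    chart at x0, while nu(x) may come from another chart.  If f points strictly
    into Omega at x according to some chart, then the half-line x + t f enters
    Omega, so f.nu(x) <= 0 by [inward_velocity], whatever chart nu(x) comes
    from ([outward_normal_le0]).

    The velocity field s |-> H_i(s, X(s)) is bounded, but away from t0 it may
    be discontinuous, and its measurability is not immediate.  The integral of an arbitrary function is a
    difference of two lower integrals, and these are monotone, and additive
    over disjoint measurable domains.  That is enough to bound the increments
    of x by bounds on the velocity ([increment_bounds]). *)

(** * Lower integrals of arbitrary bounded functions *)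

Section lower_integral.
Context d (T : measurableType d) (R : realType).
Variable mu : {measure set T -> \bar R}.
Implicit Types A B D : set T.

Import HBNNSimple.

Lemma patch_setU_disjoint A B (f : T -> R) x : A `&` B = set0 ->
  (f \_ (A `|` B)) x = (f \_ A) x + (f \_ B) x.
Proof.
move=> AB; rewrite /patch in_setU.
have [xA|xA] := boolP (x \in A); have [xB|xB] := boolP (x \in B);
  rewrite /= ?addr0 ?add0r//.
by have []: (A `&` B) x -> False; [rewrite AB | split; exact: set_mem].
Qed.

Lemma sintegral_le_integral A (f : T -> \bar R) (h : {nnsfun T >-> R}) :
  (forall x, 0 <= f x)%E -> (forall x, (h x)%:E <= (f \_ A) x)%E ->
  (sintegral mu h <= \int[mu]_(x in A) f x)%E.
Proof.
move=> f0 hf; rewrite ge0_integralE//.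
by apply: ereal_sup_ubound; exists h.
Qed.

Lemma ge0_le_integral_lower D (f g : T -> \bar R) :
  (forall x, D x -> 0 <= f x)%E -> (forall x, D x -> f x <= g x)%E ->
  (\int[mu]_(x in D) f x <= \int[mu]_(x in D) g x)%E.
Proof.
move=> f0 fg; rewrite !ge0_integralE//; last first.
  by move=> x Dx; exact: le_trans (f0 x Dx) (fg x Dx).
apply: le_ereal_sup => _ [h /= hf <-]; exists h => // x.
by apply: le_trans (hf x) _; rewrite /patch; case: ifPn => // /set_mem /fg.
Qed.

(** A simple function below [f] on the union splits into its restrictions to
    [A] and [B], which are simple because the domains are measurable, and
    conversely simple functions below [f] on [A] and on [B] add up. *)
Lemma ge0_integral_setU_lower A B (f : T -> \bar R) :
  measurable A -> measurable B -> A `&` B = set0 ->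
  (forall x, 0 <= f x)%E ->
  (\int[mu]_(x in A `|` B) f x =
   \int[mu]_(x in A) f x + \int[mu]_(x in B) f x)%E.
Proof.
move=> mA mB AB f0.
have mAB := measurableU _ _ mA mB.
have restr (C D : set T) (h : {nnsfun T >-> R}) (mC : measurable C) : C `<=` D ->
    (forall x, (h x)%:E <= (f \_ D) x)%E ->
    (forall x, (proj_nnsfun h mC x)%:E <= (f \_ C) x)%E.
  move=> CD hf x; rewrite -mrestrict /patch.
  case: ifPn => // xC; apply: le_trans (hf x) _.
  by rewrite /patch ifT// inE; apply: CD; exact: set_mem.
apply/eqP; rewrite eq_le; apply/andP; split.
- rewrite [leLHS]ge0_integralE//; apply: ge_ereal_sup => _ [h /= hf <-].
  have hE : h =1 (proj_nnsfun h mA \+ proj_nnsfun h mB).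
    move=> x; rewrite -!mrestrict /= -patch_setU_disjoint// /patch.
    case: ifPn => // xAB; apply/eqP; rewrite eq_le fun_ge0 andbT -lee_fin.
    by apply: le_trans (hf x) _; rewrite /patch (negbTE xAB).
  rewrite (eq_sintegral _ _ hE) sintegralD//.
  apply: leeD; apply: sintegral_le_integral => //.
    by apply: restr hf => // x; left.
  by apply: restr hf => // x; right.
have [->|ABfin] := eqVneq (\int[mu]_(x in A `|` B) f x)%E +oo%E; first exact: leey.
have mono (C : set T) : C `<=` A `|` B ->
    (\int[mu]_(x in C) f x <= \int[mu]_(x in A `|` B) f x)%E.
  move=> CAB; rewrite [leLHS]ge0_integralE//; apply: ge_ereal_sup => _ [h /= hf <-].
  apply: sintegral_le_integral => // x; apply: le_trans (hf x) _.
  rewrite /patch; case: ifPn => xC; last by case: ifPn.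
  by rewrite ifT// inE; apply: CAB; exact: set_mem.
have fin (C : set T) : C `<=` A `|` B -> (\int[mu]_(x in C) f x)%E \is a fin_num.
  move=> CAB; rewrite ge0_fin_numE ?integral_ge0//.
  by rewrite (le_lt_trans (mono _ CAB))// ltey.
have fA := fin _ (@subsetUl _ A B); have fB := fin _ (@subsetUr _ A B).
rewrite -leeBrDr//.
rewrite [leLHS]ge0_integralE//; apply: ge_ereal_sup => _ [h /= hf <-].
have sfin : sintegral mu h \is a fin_num.
  rewrite ge0_fin_numE ?sintegral_ge0//.
  by rewrite (le_lt_trans (sintegral_le_integral f0 hf))// ltey_eq fA.
rewrite leeBrDr// addeC -leeBrDr//.
rewrite [leLHS]ge0_integralE//; apply: ge_ereal_sup => _ [k /= kf <-].
rewrite leeBrDr// -sintegralD//.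
apply: (@sintegral_le_integral _ _ (add_nnsfun k h)) => // x.
have := hf x; have := kf x; rewrite /patch in_setU EFinD.
have [xA|xA] := boolP (x \in A); have [xB|xB] := boolP (x \in B) => /=.
- by have []: (A `&` B) x -> False; [rewrite AB | split; exact: set_mem].
- by move=> k0 hfx; rewrite -[leRHS]add0e; exact: leeD.
- by move=> k0 hfx; rewrite -[leRHS]adde0; exact: leeD.
- by move=> k0 hfx; rewrite -[leRHS]adde0; exact: leeD.
Qed.

Section bounded_function.
Variables (A : set T) (f : T -> R) (a b : R).
Hypotheses (mA : measurable A) (finA : (mu A < +oo)%E).
Hypothesis fab : forall x, A x -> a <= f x <= b.

Lemma integral_posneg_bounds :
  ((Num.max a 0 * fine (mu A))%:E <= \int[mu]_(x in A) ((EFin \o f)^\+ x)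
     <= (Num.max b 0 * fine (mu A))%:E)%E /\
  ((Num.max (- b) 0 * fine (mu A))%:E <= \int[mu]_(x in A) ((EFin \o f)^\- x)
     <= (Num.max (- a) 0 * fine (mu A))%:E)%E.
Proof.
have cstE r : ((r * fine (mu A))%:E = \int[mu]_(x in A) (cst r%:E) x)%E.
  by rewrite integral_cst// EFinM fineK// ge0_fin_numE.
have m0 (r : R) : (0 <= (Num.max r 0)%:E)%E by rewrite lee_fin le_max lexx orbT.
have mM (r s : R) : r <= s -> Num.max r 0 <= Num.max s 0.
  by rewrite ge_max !le_max lexx orbT andbT => ->.
rewrite !cstE; split; apply/andP; split; apply: ge0_le_integral_lower;
  rewrite ?funeposE ?funenegE //= => x /fab/andP[h1 h2];
  rewrite ?funeposE ?funenegE //= -?EFinN -EFin_max lee_fin mM//; lra.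
Qed.

Lemma integral_posneg_fin :
  (\int[mu]_(x in A) ((EFin \o f)^\+ x))%E \is a fin_num /\
  (\int[mu]_(x in A) ((EFin \o f)^\- x))%E \is a fin_num.
Proof.
have [/andP[_ h1] /andP[_ h2]] := integral_posneg_bounds.
split; rewrite ge0_fin_numE ?integral_ge0//.
- exact: le_lt_trans h1 (ltry _).
- exact: le_lt_trans h2 (ltry _).
Qed.

Lemma Rintegral_posneg :
  \int[mu]_(x in A) f x = fine (\int[mu]_(x in A) ((EFin \o f)^\+ x))%E -
                          fine (\int[mu]_(x in A) ((EFin \o f)^\- x))%E.
Proof.
by have [h1 h2] := integral_posneg_fin; rewrite /Rintegral integralE fineB.
Qed.

Lemma Rintegral_bounds :
  a * fine (mu A) <= \int[mu]_(x in A) f x <= b * fine (mu A).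
Proof.
have [h1 h2] := integral_posneg_fin; have [] := integral_posneg_bounds.
rewrite Rintegral_posneg -(fineK h1) -(fineK h2) !lee_fin.
have mE (r : R) : Num.max r 0 - Num.max (- r) 0 = r.
  by rewrite !maxEle; case: leP => ?; case: leP => ?; lra.
move=> /andP[p1 p2] /andP[n1 n2].
rewrite -[X in X * _ <= _]mE -[X in _ <= X * _](mE b) !mulrBl.
by apply/andP; split; apply: lerB.
Qed.

End bounded_function.

Lemma Rintegral_setU_lower A B (f : T -> R) (a b : R) :
  measurable A -> measurable B -> A `&` B = set0 ->
  (mu (A `|` B) < +oo)%E -> (forall x, (A `|` B) x -> a <= f x <= b) ->
  \int[mu]_(x in A `|` B) f x = \int[mu]_(x in A) f x + \int[mu]_(x in B) f x.
Proof.
move=> mA mB AB fin fab.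
have mAB := measurableU _ _ mA mB.
have finA : (mu A < +oo)%E.
  by apply: le_lt_trans fin; apply: le_measure; rewrite ?inE.
have finB : (mu B < +oo)%E.
  by apply: le_lt_trans fin; apply: le_measure; rewrite ?inE.
have fabA x : A x -> a <= f x <= b by move=> h; apply: fab; left.
have fabB x : B x -> a <= f x <= b by move=> h; apply: fab; right.
rewrite (Rintegral_posneg mAB fin fab).
rewrite (Rintegral_posneg mA finA fabA) (Rintegral_posneg mB finB fabB).
have [a1 a2] := integral_posneg_fin mA finA fabA.
have [b1 b2] := integral_posneg_fin mB finB fabB.
by rewrite !ge0_integral_setU_lower// (fineD a1 b1) (fineD a2 b2) opprD addrACA.
Qed.

End lower_integral.

(** * Limits of vectors and right derivatives of curves *)

Section limits.
Context {R : realType}.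

Lemma cvg_near_eq (T : Type) (U : topologicalType) (F : set_system T)
    {FF : Filter F} (f g : T -> U) (l : U) :
  (\forall x \near F, f x = g x) -> f @ F --> l -> g @ F --> l.
Proof. by move=> fg fl A /fl; apply: filterS2 fg => x /= ->. Qed.

Lemma cvg_mx (m n : nat) (T : Type) (F : set_system T) {FF : Filter F}
    (f : T -> 'M[R]_(m, n)) (l : 'M[R]_(m, n)) :
  (forall i j, f x i j @[x --> F] --> l i j) -> f @ F --> l.
Proof.
move=> h A [P Pl PA].
have : \forall x \near F, forall i j, P i j (f x i j).
  apply: filter_forall => i; apply: filter_forall => j.
  exact: h (Pl i j).
by apply: filterS => x /= Px; apply: PA.
Qed.

Lemma cvg_coord (m n : nat) (T : Type) (F : set_system T) {FF : Filter F}
    (f : T -> 'M[R]_(m, n)) (l : 'M[R]_(m, n)) i j :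
  f @ F --> l -> f x i j @[x --> F] --> l i j.
Proof.
move=> fl.
exact: (cvg_comp f (fun M : 'M[R]_(m, n) => M i j) fl
  (@coord_continuous R m n i j l)).
Qed.

Lemma cvg_sumr (T : Type) (F : set_system T) {FF : Filter F} (I : Type)
    (r : seq I) (f : I -> T -> R) (l : I -> R) :
  (forall i, f i x @[x --> F] --> l i) ->
  \sum_(i <- r) f i x @[x --> F] --> \sum_(i <- r) l i.
Proof. by move=> fl; apply: cvg_big => //; exact: add_continuous. Qed.

Lemma cvg_mulmxr (m n p : nat) (Q : 'M[R]_(n, p)) (T : Type) (F : set_system T)
    {FF : Filter F} (f : T -> 'M[R]_(m, n)) (l : 'M[R]_(m, n)) :
  f @ F --> l -> f x *m Q @[x --> F] --> l *m Q.
Proof.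
move=> fl; apply: cvg_mx => i j; rewrite mxE.
under eq_cvg do rewrite mxE.
apply: cvg_sumr => k; apply: cvgM; last exact: cvg_cst.
exact: cvg_coord.
Qed.

Lemma cvg_within_left (U : topologicalType) (f : R -> U) (l : U) (a b t : R) :
  a < t -> t <= b ->
  f s @[s --> within `[a, b] (nbhs t)] --> l -> f s @[s --> t^'-] --> l.
Proof.
move=> at_ tb fl A /fl; rewrite /nbhs /= /within /= => h.
apply: filterS2 h (nbhs_left_gt at_ : nbhs t _) => r h + rt => /(_ rt) ar.
by apply: h; rewrite in_itv /= (ltW ar) (le_trans (ltW rt)).
Qed.

Lemma cvg_within_right (U : topologicalType) (f : R -> U) (l : U) (a b t : R) :
  a <= t -> t < b ->
  f s @[s --> within `[a, b] (nbhs t)] --> l -> f s @[s --> t^'+] --> l.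
Proof.
move=> at_ tb fl A /fl; rewrite /nbhs /= /within /= => h.
apply: filterS2 h (nbhs_right_lt tb : nbhs t _) => r h + tr => /(_ tr) rb.
by apply: h; rewrite in_itv /= (ltW rb) (le_trans at_ (ltW tr)).
Qed.

End limits.

Arguments cvg_coord {R m n T F FF f l} i j _.

Section right_derivative.
Context {R : realType}.

(** Only the values of [c] at positive times matter, so the starting point [a]
    is a separate parameter. *)
Definition rderiv (V : normedModType R) (c : R -> V) (a w : V) :=
  (fun t : R => t^-1 *: (c t - a)) @ 0^'+ --> w.

Lemma rderiv_line (V : normedModType R) (a w : V) :
  rderiv (fun t => a + t *: w) a w.
Proof.
apply: cvg_near_cst; near=> t.
by rewrite addrAC subrr add0r scalerA mulVf ?scale1r// gt_eqF.
Unshelve. all: by end_near. Qed.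

Lemma rderiv_cvg (V : normedModType R) (c : R -> V) (a w : V) :
  rderiv c a w -> c t @[t --> 0^'+] --> a.
Proof.
move=> h; have t0 : (fun t : R => t) @ 0^'+ --> (0 : R) by exact: cvg_within.
rewrite -[X in _ --> X]add0r -(scale0r w).
apply: cvg_near_eq (cvgD (cvgZ t0 h) (cvg_cst a)); near=> t => /=.
by rewrite fctE scalerA mulfV ?scale1r ?subrK// gt_eqF.
Unshelve. all: by end_near. Qed.

(** Chain rule: with [q t] the difference quotient of [c], the quotient of
    [f \o c] is ['d f a (q t)] plus a remainder [o(t q t) / t], and [q] is
    bounded near 0. *)
Lemma rderiv_comp (V : normedModType R) (f : V -> R) (c : R -> V) (a w : V) :
  differentiable f a -> rderiv c a w -> rderiv (f \o c : R -> R) (f a) ('D_w f a).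
Proof.
move=> df cw; rewrite deriveE//.
have ca := rderiv_cvg cw.
have dq : 'd f a (t^-1 *: (c t - a)) @[t --> 0^'+] --> 'd f a w.
  by apply: (cvg_comp _ _ cw); exact: (diff_continuous df).
rewrite /rderiv -[X in _ --> X]add0r.
rewrite (_ : (fun _ => _) = (fun t =>
    (t^-1 *: (f (c t) - f a) - 'd f a (t^-1 *: (c t - a))) +
    'd f a (t^-1 *: (c t - a)))); last by apply/funext => t; rewrite subrK.
apply: cvgD => //.
have qb : \forall t \near 0^'+, `|t^-1 *: (c t - a)| <= `|w| + 1.
  by apply: (cvgr_norm_le _ cw); rewrite ltrDl.
apply/cvgr0Pnorm_le => e e0.
have wp : 0 < `|w| + 1 by rewrite ltr_wpDl.
have /eqaddoP := diff_locally df.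
move=> /(_ (e / (`|w| + 1))) /(_ (divr_gt0 e0 wp)) of0.
have ca0 : c t - a @[t --> 0^'+] --> 0.
  by rewrite -(subrr a); apply: cvgB => //; exact: cvg_cst.
have oc : \forall t \near 0^'+,
    `|f (c t) - (f a + 'd f a (c t - a))| <= e / (`|w| + 1) * `|c t - a|.
  have h : \forall t \near 0^'+,
      `|(f \o shift a - (cst (f a) + 'd f a)) (c t - a)| <=
      e / (`|w| + 1) * `|c t - a|.
    exact: ca0 _ of0.
  by apply: filterS h => t; rewrite !fctE /= subrK.
near=> t.
have t0 : 0 < t by near: t; exact: nbhs_right_gt.
rewrite linearZ /= -scalerBr normrZ gtr0_norm ?invr_gt0// ler_pdivrMl//.
rewrite -addrA -opprD; apply: le_trans (near oc t _) _ => //.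
rewrite mulrAC ler_pdivrMr// -mulrA mulrCA ler_pM2l//.
have : `|t^-1 *: (c t - a)| <= `|w| + 1 by near: t.
by rewrite normrZ gtr0_norm ?invr_gt0// ler_pdivrMl.
Unshelve. all: by end_near. Qed.

Lemma rderiv_gt0 (g : R -> R) (a w : R) :
  rderiv g a w -> 0 < w -> \forall t \near 0^'+, a < g t.
Proof.
move=> gw w0; near=> t.
have t0 : 0 < t by near: t; exact: nbhs_right_gt.
have : 0 < t^-1 *: (g t - a) by near: t; exact: (cvgr_gt w).
by rewrite pmulr_rgt0 ?invr_gt0// subr_gt0.
Unshelve. all: by end_near. Qed.

Lemma rderiv_ge0 (g : R -> R) (a w : R) :
  rderiv g a w -> (\forall t \near 0^'+, a <= g t) -> 0 <= w.
Proof.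
move=> gw ga; apply: (cvgr_to_ge gw); near=> t.
have t0 : 0 < t by near: t; exact: nbhs_right_gt.
apply: mulr_ge0; first by rewrite invr_ge0 ltW.
by rewrite subr_ge0; near: t.
Unshelve. all: by end_near. Qed.

End right_derivative.

(** * Increments and one-sided derivatives of indefinite integrals *)

Section indefinite_integral.
Context {R : realType}.
Variables (T x0 K : R) (g G : R -> R).
Hypothesis gK : forall s : R, 0 <= s <= T -> `|g s| <= K.
Hypothesis GE : forall t : R, 0 <= t < T ->
  G t = x0 + \int[lebesgue_measure]_(s in `[0, t]) g s.
Hypothesis Gc : forall t : R, 0 <= t <= T ->
  G s @[s --> within `[0, T] (nbhs t)] --> G t.

Lemma increment_bounds_lt (s t c d : R) : 0 <= s -> s < t -> t < T ->
  (forall u, s < u <= t -> c <= g u <= d) ->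
  c * (t - s) <= G t - G s <= d * (t - s).
Proof.
move=> s0 st tT gcd.
rewrite !GE ?s0 ?(lt_trans st)// ?(le_trans s0 (ltW st))//.
have E : `[0, t]%classic = `[0, s]%classic `|` `]s, t]%classic.
  by rewrite -itv_bndbnd_setU// bnd_simp// ltW.
have fin0 : (lebesgue_measure `[0%R, t]%classic < +oo)%E.
  by rewrite lebesgue_measure_itv /=; case: ifP => // _; rewrite -EFinB ltry.
have fin : (lebesgue_measure `]s, t]%classic < +oo)%E.
  by rewrite lebesgue_measure_itv /= lte_fin st -EFinB ltry.
rewrite E (@Rintegral_setU_lower _ _ _ _ _ _ _ (- K) K)//.
- have len : fine (lebesgue_measure `]s, t]%classic) = t - s.
    by rewrite lebesgue_measure_itv /= lte_fin st.
  have := @Rintegral_bounds _ _ _ lebesgue_measure `]s, t]%classic g c d.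
  rewrite len opprD addrACA subrr add0r addrAC subrr add0r.
  by apply.
- rewrite -subset0 => u [] /=; rewrite !in_itv /= => /andP[_ us] /andP[su _].
  by move: (lt_le_trans su us); rewrite ltxx.
- by rewrite -E.
- move=> u; rewrite -E /= in_itv /= => /andP[u0 ut]; rewrite -ler_norml.
  by apply: gK; rewrite u0 (le_trans ut)// ltW.
Qed.

(** Passing to the limit at the right end point also reaches [t = T], where
    the integral formula for [G] is not assumed, and requires the bounds on
    the open interval only. *)
Lemma increment_bounds (s t c d : R) : 0 <= s -> s < t -> t <= T ->
  (forall u, s < u < t -> c <= g u <= d) ->
  c * (t - s) <= G t - G s <= d * (t - s).
Proof.
move=> s0 st tT gcd.
have t0 : 0 < t by exact: le_lt_trans s0 st.
have Gl : G r @[r --> t^'-] --> G t.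
  by apply: (cvg_within_left t0 tT (Gc _)); rewrite (ltW t0).
have lin (a : R) : a * (r - s) @[r --> t^'-] --> a * (t - s).
  apply: cvgM; first exact: cvg_cst.
  by apply: cvgB; [exact: cvg_within|exact: cvg_cst].
have GB : G r - G s @[r --> t^'-] --> G t - G s.
  by apply: cvgB => //; exact: cvg_cst.
have near_bd : \forall r \near t^'-, c * (r - s) <= G r - G s <= d * (r - s).
  near=> r.
  have sr : s < r by near: r; exact: nbhs_left_gt.
  have rt : r < t by near: r; exact: nbhs_left_lt.
  apply: increment_bounds_lt => //; first exact: lt_le_trans tT.
  by move=> u /andP[su ur]; apply: gcd; rewrite su (le_lt_trans ur).
apply/andP; split.
- by apply: (ler_cvg_to (lin c) GB); apply: filterS near_bd => r /andP[].
- by apply: (ler_cvg_to GB (lin d)); apply: filterS near_bd => r /andP[].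
Unshelve. all: by end_near. Qed.

Lemma rderiv_right (t a : R) : 0 <= t -> t < T -> g r @[r --> t^'+] --> a ->
  rderiv (fun h => G (t + h) : R) (G t) a.
Proof.
move=> t0 tT ga; apply/cvgrPdist_le => e e0.
have [d /= d0 hd] := (cvgrPdist_le _ _).1 ga _ e0.
near=> h.
have h0 : 0 < h by near: h; exact: nbhs_right_gt.
have hd' : h < d by near: h; exact: nbhs_right_lt.
have hT : t + h <= T.
  by rewrite -lerBrDl; near: h; apply: nbhs_right_ltW; rewrite subr_gt0.
have := @increment_bounds t (t + h) (a - e) (a + e) t0.
rewrite ltrDl h0 => /(_ isT hT) bd.
have /andP[b1 b2] :
    (a - e) * (t + h - t) <= G (t + h) - G t <= (a + e) * (t + h - t).
  apply: bd => u /andP[tu uth]; rewrite -ler_distlC; apply: hd => //=.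
  by rewrite ltr0_norm ?subr_lt0// opprB; lra.
rewrite ler_distlC; move: b1 b2; rewrite addrAC subrr add0r => b1 b2.
by apply/andP; split; [rewrite ler_pdivlMl// mulrC|rewrite ler_pdivrMl// mulrC].
Unshelve. all: by end_near. Qed.

Lemma rderiv_left (t a : R) : 0 < t -> t <= T -> g r @[r --> t^'-] --> a ->
  rderiv (fun h => G (t - h) : R) (G t) (- a).
Proof.
move=> t0 tT ga; apply/cvgrPdist_le => e e0.
have [d /= d0 hd] := (cvgrPdist_le _ _).1 ga _ e0.
near=> h.
have h0 : 0 < h by near: h; exact: nbhs_right_gt.
have hd' : h < d by near: h; exact: nbhs_right_lt.
have ht : 0 <= t - h by rewrite subr_ge0; near: h; apply: nbhs_right_ltW.
have := @increment_bounds (t - h) t (a - e) (a + e) ht.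
rewrite gtrBl h0 => /(_ isT tT) bd.
have /andP[b1 b2] :
    (a - e) * (t - (t - h)) <= G t - G (t - h) <= (a + e) * (t - (t - h)).
  apply: bd => u /andP[tu uth]; rewrite -ler_distlC; apply: hd => //=.
  by rewrite gtr0_norm ?subr_gt0//; lra.
move: b1 b2; rewrite subKr => b1 b2.
by rewrite ler_distlC; apply/andP; split;
  [rewrite ler_pdivlMl//|rewrite ler_pdivrMl//]; lra.
Unshelve. all: by end_near. Qed.

End indefinite_integral.

(** * The height above the graph of a chart, and its differential *)

Section gap.
Context {R : realType} {m : nat}.
Implicit Types (Q : 'M[R]_m.+1) (gamma : 'rV[R]_m -> R) (x w v : 'rV[R]_m.+1).

Definition gap Q gamma x : R := lst Q x - gamma (hd Q x).

(** The differential of [gap] at [x] in the direction [w]; its kernel is the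
    tangent space of the graph. *)
Definition dgap Q gamma x w : R := lst Q w - 'D_(hd Q w) gamma (hd Q x).

Lemma hdP Q k x w : hd Q (k *: x + w) = k *: hd Q x + hd Q w.
Proof.
by rewrite /hd mulmxDl -scalemxAl; apply/rowP => j; rewrite !mxE.
Qed.

Lemma lstP Q k x w : lst Q (k *: x + w) = k * lst Q x + lst Q w.
Proof. by rewrite /lst mulmxDl -scalemxAl !mxE. Qed.

Lemma hdZ Q k x : hd Q (k *: x) = k *: hd Q x.
Proof. by rewrite /hd -scalemxAl; apply/rowP => j; rewrite !mxE. Qed.

Lemma lstZ Q k x : lst Q (k *: x) = k * lst Q x.
Proof. by rewrite /lst -scalemxAl mxE. Qed.

Lemma hdB Q x w : hd Q (x - w) = hd Q x - hd Q w.
Proof. by rewrite /hd mulmxBl; apply/rowP => j; rewrite !mxE. Qed.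

Lemma lstB Q x w : lst Q (x - w) = lst Q x - lst Q w.
Proof. by rewrite /lst mulmxBl [LHS]mxE [X in _ + X]mxE. Qed.

Lemma dgapP Q gamma x k w v : differentiable gamma (hd Q x) ->
  dgap Q gamma x (k *: w + v) = k * dgap Q gamma x w + dgap Q gamma x v.
Proof.
move=> dg; rewrite /dgap !deriveE// lstP hdP linearD linearZ /= mulrBr.
by rewrite opprD addrACA.
Qed.

Lemma dgap0 Q gamma x : dgap Q gamma x 0 = 0.
Proof. by rewrite /dgap -(scale0r 0) lstZ hdZ mul0r scale0r derive0 subrr. Qed.

Lemma cvg_lst Q (T : Type) (F : set_system T) {FF : Filter F}
    (f : T -> 'rV[R]_m.+1) l :
  f @ F --> l -> lst Q (f x) @[x --> F] --> lst Q l.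
Proof. by move=> fl; apply: cvg_coord; exact: cvg_mulmxr. Qed.

Lemma cvg_hd Q (T : Type) (F : set_system T) {FF : Filter F}
    (f : T -> 'rV[R]_m.+1) l :
  f @ F --> l -> hd Q (f x) @[x --> F] --> hd Q l.
Proof.
move=> fl; apply: cvg_mx => i j; rewrite mxE; under eq_cvg do rewrite mxE.
by apply: cvg_coord; exact: cvg_mulmxr.
Qed.

Lemma cvg_gap Q gamma (T : Type) (F : set_system T) {FF : Filter F}
    (f : T -> 'rV[R]_m.+1) l :
  differentiable gamma (hd Q l) -> f @ F --> l ->
  gap Q gamma (f x) @[x --> F] --> gap Q gamma l.
Proof.
move=> dg fl; apply: cvgB; first exact: cvg_lst.
apply: (cvg_comp (hd Q \o f) gamma (cvg_hd fl)).
exact: (differentiable_continuous dg).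
Qed.

Lemma derive_coord gamma (y v : 'rV[R]_m) : differentiable gamma y ->
  'D_v gamma y = \sum_j v 0 j * 'D_(delta_mx 0 j) gamma y.
Proof.
move=> dg; rewrite deriveE// {1}(row_sum_delta v) linear_sum.
by apply: eq_bigr => j _; rewrite linearZ deriveE.
Qed.

(** Joint continuity in the base point and the direction: expanding in a basis
    reduces it to the continuity of the partial derivatives of [gamma]. *)
Lemma cvg_dgap Q gamma (T : Type) (F : set_system T) {FF : Filter F}
    (c f : T -> 'rV[R]_m.+1) x w :
  C1_fun gamma -> c @ F --> x -> f @ F --> w ->
  dgap Q gamma (c t) (f t) @[t --> F] --> dgap Q gamma x w.
Proof.
move=> [dg cg] cx fw; apply: cvgB; first exact: cvg_lst.
rewrite derive_coord//; under eq_cvg do rewrite derive_coord//.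
apply: cvg_sumr => j; apply: cvgM.
  by apply: cvg_coord; exact: cvg_hd.
exact: (cvg_comp (hd Q \o c) _ (cvg_hd cx) (cg _ _)).
Qed.

Lemma C2_C1 (V W : normedModType R) (f : V -> W) : C2_fun f -> C1_fun f.
Proof.
by move=> [df d2]; split=> // v x; exact: (differentiable_continuous ((d2 v).1 x)).
Qed.

Lemma rderiv_gap Q gamma (c : R -> 'rV[R]_m.+1) x w :
  differentiable gamma (hd Q x) -> rderiv c x w ->
  rderiv (fun t => gap Q gamma (c t) : R) (gap Q gamma x) (dgap Q gamma x w).
Proof.
move=> dg cw.
have hw : rderiv (hd Q \o c) (hd Q x) (hd Q w).
  by apply: (cvg_near_eq _ (cvg_hd cw)); apply: nearW => t; rewrite /= -hdB hdZ.
have lw : rderiv (lst Q \o c : R -> R) (lst Q x) (lst Q w).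
  by apply: (cvg_near_eq _ (cvg_lst cw)); apply: nearW => t; rewrite /= -lstB lstZ.
have gw := rderiv_comp dg hw.
apply: (cvg_near_eq _ (cvgB lw gw)); apply: nearW => t.
by rewrite !fctE /= -scalerBr; congr (_ *: _); rewrite /gap; lra.
Qed.

End gap.

(** * Unit normals of a chart *)

Section normal.
Context {R : realType} {m : nat}.
Implicit Types (Q : 'M[R]_m.+1) (gamma : 'rV[R]_m -> R) (x w v : 'rV[R]_m.+1).

Lemma dotE v w : dot v w = (v *m w^T) 0 0.
Proof. by rewrite mxE; apply: eq_bigr => j _; rewrite mxE. Qed.

Lemma dotC v w : dot v w = dot w v.
Proof. by apply: eq_bigr => j _; rewrite mulrC. Qed.

Lemma dotP k v w u : dot v (k *: w + u) = k * dot v w + dot v u.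
Proof. by rewrite !dotE linearD linearZ /= mulmxDr -scalemxAr !mxE. Qed.

Lemma dotNl v w : dot (- v) w = - dot v w.
Proof. by rewrite /dot -sumrN; apply: eq_bigr => j _; rewrite mxE mulNr. Qed.

(** The last vector of the orthonormal frame of the chart. *)
Definition up_vec Q : 'rV[R]_m.+1 := delta_mx 0 ord_max *m Q^T.

Lemma hd_up_vec Q : Q *m Q^T = 1%:M -> hd Q (up_vec Q) = 0.
Proof.
move=> /mulmx1C QQ; rewrite /hd /up_vec -mulmxA QQ mulmx1; apply/rowP => j.
by rewrite !mxE eq_sym (negbTE (neq_lift _ _)) andbF.
Qed.

Lemma lst_up_vec Q : Q *m Q^T = 1%:M -> lst Q (up_vec Q) = 1.
Proof.
by move=> /mulmx1C QQ; rewrite /lst /up_vec -mulmxA QQ mulmx1 mxE !eqxx.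
Qed.

Lemma dot_up_vec Q v : dot v (up_vec Q) = lst Q v.
Proof. by rewrite dotE /up_vec trmx_mul trmxK trmx_delta mulmxA -colE mxE. Qed.

Lemma dgap_up_vec Q gamma x : Q *m Q^T = 1%:M -> dgap Q gamma x (up_vec Q) = 1.
Proof. by move=> QQ; rewrite /dgap hd_up_vec// lst_up_vec// derive0 subr0. Qed.

(** A vector orthogonal to the kernel of the linear form [dgap Q gamma x] is a
    multiple of that form, and evaluation at [up_vec Q] gives the factor.  For
    an outward normal the factor [lst Q v] is negative, so [dot v w] and
    [dgap Q gamma x w] have opposite signs. *)
Lemma normal_dot Q gamma x v w : Q *m Q^T = 1%:M ->
  differentiable gamma (hd Q x) ->
  (forall u, lst Q u = 'D_(hd Q u) gamma (hd Q x) -> dot v u = 0) ->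
  dot v w = dgap Q gamma x w * lst Q v.
Proof.
move=> QQ dg orth.
have := orth (- dgap Q gamma x w *: up_vec Q + w); rewrite dotP dot_up_vec => h.
apply/eqP; rewrite -subr_eq0 addrC -mulNr; apply/eqP/h/eqP.
by rewrite -subr_eq0 -/(dgap _ _ _ _) dgapP// dgap_up_vec// mulr1 addNr.
Qed.

(** Minus the normalized gradient [g] of [gap]; the gradient is nonzero because
    the derivative along [up_vec Q] is 1. *)
Lemma exists_normal Q gamma x : Q *m Q^T = 1%:M ->
  differentiable gamma (hd Q x) ->
  exists v, [/\ dot v v = 1,
        forall w, lst Q w = 'D_(hd Q w) gamma (hd Q x) -> dot v w = 0 &
        lst Q v < 0].
Proof.
move=> QQ dg.
pose g : 'rV[R]_m.+1 := \row_j dgap Q gamma x (delta_mx 0 j).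
have gE w : dot g w = dgap Q gamma x w.
  rewrite {2}(row_sum_delta w) /dot.
  transitivity (\sum_j w 0 j * dgap Q gamma x (delta_mx 0 j)).
    by apply: eq_bigr => j _; rewrite mxE mulrC.
  apply/esym; elim/big_ind2: _ => //.
  - exact: dgap0.
  - by move=> u a v b <- <-; rewrite -[a]scale1r dgapP// mul1r scale1r.
  - by move=> j _; rewrite -[_ *: _]addr0 dgapP// dgap0 addr0.
have gup : lst Q g = 1 by rewrite -dot_up_vec gE dgap_up_vec.
have gg : 0 < dot g g.
  have : 0 <= dot g g by apply: sumr_ge0 => j _; rewrite -expr2 sqr_ge0.
  rewrite le_eqVlt => /predU1P[/esym/eqP|//].
  rewrite psumr_eq0; last by move=> j _; rewrite -expr2 sqr_ge0.
  move=> /allP g0; suff g00 : g = 0.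
    by move: gup; rewrite g00 /lst mul0mx mxE => /esym/eqP; rewrite oner_eq0.
  apply/rowP => j; rewrite [RHS]mxE; apply/eqP.
  by have := g0 j (mem_index_enum j); rewrite /= mulf_eq0 orbb.
pose k := - (Num.sqrt (dot g g))^-1.
have dk w : dot (k *: g) w = k * dgap Q gamma x w.
  by rewrite -gE !dotE -scalemxAl mxE.
exists (k *: g); split.
- rewrite dk -gE dotC dk -gE mulrA /k mulrNN -invfM -expr2 sqr_sqrtr ?ltW//.
  by rewrite mulVf// gt_eqF.
- by move=> w h; rewrite dk /dgap h subrr mulr0.
- by rewrite lstZ gup mulr1 oppr_lt0 invr_gt0 sqrtr_gt0.
Qed.

End normal.

(** * Velocities at the boundary and the projected field *)

Section domain.
Context {R : realType} {m : nat}.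
Implicit Types (Q : 'M[R]_m.+1) (gamma : 'rV[R]_m -> R).
Implicit Types (x w f : 'rV[R]_m.+1) (Omega : set 'rV[R]_m.+1).

Lemma C2_chart_near Omega x Q gamma : C2_chart Omega x Q gamma ->
  \forall y \near x, C2_chart Omega y Q gamma.
Proof.
by move=> [QQ g2 /nbhs_interior]; apply: filterS => y ny; split=> //; exact: ny.
Qed.

Lemma gap_ge0 Omega x Q gamma :
  C2_chart Omega x Q gamma -> closure Omega x -> 0 <= gap Q gamma x.
Proof.
move=> [QQ [dg _] ch] clx; rewrite leNgt; apply/negP => gx.
have gc : gap Q gamma y @[y --> x] --> gap Q gamma x.
  exact: (@cvg_gap _ _ Q gamma _ (nbhs x) _ id x (dg _) (fun A h => h)).
have [y [Oy []]] := clx _ (filterI ch (@cvgr_lt _ _ _ _ _ _ gc 0 gx)).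
by move=> [/(_ Oy) + _]; rewrite /= /gap subr_lt0 => /ltW; rewrite leNgt => /negP.
Qed.

Lemma gap_boundary Omega x Q gamma : open Omega -> C2_chart Omega x Q gamma ->
  boundary Omega x -> gap Q gamma x = 0.
Proof.
move=> oO ch [clx nix]; apply/eqP; rewrite eq_le (gap_ge0 ch clx) andbT leNgt.
apply/negP; rewrite subr_gt0 => gx; apply: nix; apply: open_nbhs_nbhs; split=> //.
by case: ch => _ _ /nbhs_singleton -[_]; apply.
Qed.

Lemma outward_unit_normalP Omega x : C2_boundary Omega -> boundary Omega x ->
  is_outward_unit_normal Omega x (outward_unit_normal Omega x).
Proof.
move=> CO bx; have [Q [gamma ch]] := CO x bx.
apply: (@getPex _ (is_outward_unit_normal Omega x)).
have [QQ [dg _] _] := ch.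
have [v [v1 v2 v3]] := exists_normal QQ (dg (hd Q x)).
by exists v, Q, gamma; split.
Qed.

(** In the chart that defines the normal, [gap] vanishes at [x] and is
    nonnegative along the curve, so its right derivative, which is a negative
    multiple of [dot w nu], is nonnegative. *)
Lemma inward_velocity Omega x (c : R -> 'rV[R]_m.+1) w :
  open Omega -> C2_boundary Omega -> boundary Omega x -> rderiv c x w ->
  (\forall t \near 0^'+, closure Omega (c t)) ->
  dot w (outward_unit_normal Omega x) <= 0.
Proof.
move=> oO CO bx cw cO.
have [Q [gamma [ch _ orth lv]]] := outward_unit_normalP CO bx.
have [QQ [dg _] _] := ch.
rewrite dotC (normal_dot _ QQ (dg _) orth) nmulr_lle0//.
apply: (rderiv_ge0 (rderiv_gap (dg _) cw)).
rewrite (gap_boundary oO ch bx).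
have := rderiv_cvg cw (C2_chart_near ch).
by apply: filterS2 cO => t; [exact: (fun a b => gap_ge0 b a)].
Qed.

(** The half-line from [x] in the direction [f] enters [Omega], so
    [inward_velocity] applies to it.  The chart [(Q, gamma)] is arbitrary: it
    may differ from the one from which the normal at [x] was obtained. *)
Lemma outward_normal_le0 Omega x Q gamma f : open Omega -> C2_boundary Omega ->
  C2_chart Omega x Q gamma -> boundary Omega x -> 0 < dgap Q gamma x f ->
  dot f (outward_unit_normal Omega x) <= 0.
Proof.
move=> oO CO ch bx gf; have [QQ [dg _] _] := ch.
have line := @rderiv_line _ _ x f.
apply: (inward_velocity oO CO bx line).
have := rderiv_gt0 (rderiv_gap (dg _) line) gf.
rewrite (gap_boundary oO ch bx) => gp.
have := rderiv_cvg line (C2_chart_near ch) => nc.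
apply: filterS2 gp nc => t gt [_ _ /nbhs_singleton ct].
by apply: subset_closure; apply/ct; rewrite -subr_gt0.
Qed.

Lemma dgap_gt0_of_normal_lt0 Omega x f : C2_boundary Omega ->
  boundary Omega x -> dot f (outward_unit_normal Omega x) < 0 ->
  exists Q gamma, C2_chart Omega x Q gamma /\ 0 < dgap Q gamma x f.
Proof.
move=> CO bx.
have [Q [gamma [ch _ orth lv]]] := outward_unit_normalP CO bx.
have [QQ [dg _] _] := ch.
rewrite dotC (normal_dot _ QQ (dg _) orth) nmulr_llt0// => h.
by exists Q, gamma; split.
Qed.

Lemma proj_id Omega x f :
  (boundary Omega x -> dot f (outward_unit_normal Omega x) <= 0) ->
  Defs.proj Omega x f = f.
Proof.
by move=> h; rewrite /Defs.proj; case: asboolP => // -[bx]; rewrite ltNge h.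
Qed.

(** The coordinates of the unit normal are at most 1 in absolute value, so
    [`|dot f nu|] is at most the sum of the [`|f 0 k|]. *)
Lemma proj_bound Omega x f K : C2_boundary Omega -> (forall j, `|f 0 j| <= K) ->
  forall j, `|Defs.proj Omega x f 0 j| <= K + K *+ m.+1.
Proof.
move=> CO fK j.
have K0 : 0 <= K by exact: le_trans (fK j).
rewrite /Defs.proj; case: asboolP => [[bx _]|_]; last first.
  by rewrite (le_trans (fK j))// lerDl mulrn_wge0.
have [Q [gamma [_ nu1 _ _]]] := outward_unit_normalP CO bx.
set nu := outward_unit_normal Omega x in nu1 *.
have nuj k : `|nu 0 k| <= 1.
  rewrite -(@expr_le1 _ 2)// -normrX ger0_norm ?sqr_ge0// -nu1 /dot (bigD1 k)//=.
  by rewrite -expr2 lerDl; apply: sumr_ge0 => l _; rewrite -expr2 sqr_ge0.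
rewrite !mxE (le_trans (ler_normB _ _))// lerD// normrM.
apply: (@le_trans _ _ (`|dot f nu| * 1)); first by rewrite ler_wpM2l.
rewrite mulr1 (le_trans (ler_norm_sum _ _ _))//.
apply: (@le_trans _ _ (\sum_(k < m.+1) K)).
  by apply: ler_sum => k _; rewrite normrM -[leRHS]mulr1; exact: ler_pM.
by rewrite sumr_const card_ord.
Qed.

End domain.

(** * One-sided velocities of mild solutions *)

Section mild.
Context {R : realType} {m n : nat}.
Variables (Omega : set 'rV[R]_m.+1) (T : R) (X0 : 'M[R]_(n, m.+1))
    (F : 'I_n -> R * 'M[R]_(n, m.+1) -> 'rV[R]_m.+1)
    (X : R -> 'M[R]_(n, m.+1)).
Implicit Types (i : 'I_n) (t : R).
Hypothesis F_cont :
  forall i, {within `[0, T] `*` conf_space Omega, continuous (F i)}.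
Hypothesis X_mild : mild_solution Omega T X0 F X.
Hypothesis Omega_C2 : C2_boundary Omega.

Let H i s := proj_field Omega F i s (X s).

Lemma cvg_path i t : 0 <= t <= T ->
  row i (X s) @[s --> within `[0, T] (nbhs t)] --> row i (X t).
Proof.
move=> tT; have [/subspace_continuousP c _ _] := X_mild i.
by apply: c; rewrite /= in_itv.
Qed.

Lemma cvg_config t : 0 <= t <= T ->
  X s @[s --> within `[0, T] (nbhs t)] --> X t.
Proof.
move=> tT; apply: cvg_mx => i j.
have -> : X t i j = row i (X t) 0 j by rewrite mxE.
apply: (cvg_near_eq _ (cvg_coord 0 j (@cvg_path i _ tT))).
by apply: nearW => s; rewrite mxE.
Qed.

Lemma config_in_G t : 0 <= t <= T -> conf_space Omega (X t).
Proof. by move=> tT i; have [_ h _] := X_mild i; exact: h. Qed.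

Lemma cvg_force i t : 0 <= t <= T ->
  F i (s, X s) @[s --> within `[0, T] (nbhs t)] --> F i (t, X t).
Proof.
move=> tT; have /subspace_continuousP c := @F_cont i.
have D0 : (`[0, T] `*` conf_space Omega) (t, X t).
  by split; [rewrite /= in_itv|exact: config_in_G].
have pc : (s, X s) @[s --> within `[0, T] (nbhs t)] --> (t, X t).
  apply: (@cvg_pair _ _ _ _ (nbhs t) (nbhs (X t)) _ _ _ id X).
    exact: cvg_within.
  exact: cvg_config.
move=> A /(c _ D0) /pc; rewrite /nbhs /= /within /=; apply: filterS => s h sT.
by apply: h => //; split=> //=; apply: config_in_G; move: sT; rewrite in_itv.
Qed.

Lemma norm_coord_le (p q : nat) (A : 'M[R]_(p, q)) k l : `|A k l| <= `|A|.
Proof.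
rewrite [leRHS]/Num.norm /= mx_normrE.
by rewrite (le_bigmax _ (fun ij => `|A ij.1 ij.2|) (k, l)).
Qed.

Lemma force_bounded i :
  exists K, forall t, 0 <= t <= T -> forall j, `|F i (t, X t) 0 j| <= K.
Proof.
have c : {within `[0, T], continuous (fun t => F i (t, X t))}.
  by apply/subspace_continuousP => t; rewrite /= in_itv; exact: cvg_force.
have [M [_ Mb]] := compact_bounded (continuous_compact c (@segment_compact R 0 T)).
exists (M + 1) => t tT j; apply: le_trans (norm_coord_le _ _ _) _.
by apply: (Mb (M + 1)); [rewrite ltrDl|exists t; rewrite //= in_itv].
Qed.

Lemma velocity_bounded i j :
  exists K, forall s, 0 <= s <= T -> `|H i s 0 j| <= K.
Proof.
have [K hK] := force_bounded i; exists (K + K *+ m.+1) => s sT.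
by apply: proj_bound => // k; exact: hK.
Qed.

Lemma path_coordE i j t : 0 <= t < T ->
  row i (X t) 0 j = X0 i j + \int[lebesgue_measure]_(s in `[0, t]) (H i s 0 j).
Proof. by move=> tT; have [_ _ /(_ t tT) ->] := X_mild i; rewrite !mxE. Qed.

Lemma cvg_path_coord i j t : 0 <= t <= T ->
  row i (X r) 0 j @[r --> within `[0, T] (nbhs t)] --> row i (X t) 0 j.
Proof. by move=> tT; exact: cvg_coord (cvg_path tT). Qed.

Lemma path_at_left i t : 0 < t -> t <= T ->
  row i (X s) @[s --> t^'-] --> row i (X t).
Proof.
by move=> t0 tT; apply: (cvg_within_left t0 tT (cvg_path _)); rewrite (ltW t0).
Qed.

Lemma force_at_left i t : 0 < t -> t <= T ->
  F i (s, X s) @[s --> t^'-] --> F i (t, X t).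
Proof.
by move=> t0 tT; apply: (cvg_within_left t0 tT (cvg_force _)); rewrite (ltW t0).
Qed.

Lemma force_at_right i t : 0 <= t -> t < T ->
  F i (s, X s) @[s --> t^'+] --> F i (t, X t).
Proof.
move=> t0 tT; apply: (cvg_within_right t0 tT (cvg_force _)).
by rewrite t0 (ltW tT).
Qed.

(** The left derivative, expressed as a right derivative of the path run
    backwards. *)
Lemma path_rderiv_left i t : 0 < t -> t <= T ->
  (\forall s \near t^'-, H i s = F i (s, X s)) ->
  rderiv (fun h => row i (X (t - h))) (row i (X t)) (- F i (t, X t)).
Proof.
move=> t0 tT HF; apply: cvg_mx => k j; rewrite ord1 mxE.
have [K hK] := velocity_bounded i j.
have Hj : H i s 0 j @[s --> t^'-] --> F i (t, X t) 0 j.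
  apply: (cvg_near_eq _ (cvg_coord 0 j (@force_at_left i t t0 tT))).
  by apply: filterS HF => s ->.
apply: (cvg_near_eq _ (rderiv_left hK (@path_coordE i j)
  (@cvg_path_coord i j) t0 tT Hj)).
by apply: nearW => h; rewrite !mxE.
Qed.

Lemma path_rderiv_right i t : 0 <= t -> t < T ->
  (\forall s \near t^'+, H i s = F i (s, X s)) ->
  rderiv (fun h => row i (X (t + h))) (row i (X t)) (F i (t, X t)).
Proof.
move=> t0 tT HF; apply: cvg_mx => k j; rewrite ord1.
have [K hK] := velocity_bounded i j.
have Hj : H i s 0 j @[s --> t^'+] --> F i (t, X t) 0 j.
  apply: (cvg_near_eq _ (cvg_coord 0 j (@force_at_right i t t0 tT))).
  by apply: filterS HF => s ->.
apply: (cvg_near_eq _ (rderiv_right hK (@path_coordE i j)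
  (@cvg_path_coord i j) t0 tT Hj)).
by apply: nearW => h; rewrite !mxE.
Qed.

(** A force pointing strictly inwards at time [t] would have pushed the path
    out of the closure at earlier times. *)
Lemma force_outward i t : open Omega -> 0 < t -> t <= T ->
  boundary Omega (row i (X t)) ->
  0 <= dot (F i (t, X t)) (outward_unit_normal Omega (row i (X t))).
Proof.
move=> oO t0 tT bx; rewrite leNgt; apply/negP => neg.
have [Q [gamma [ch gF]]] := dgap_gt0_of_normal_lt0 Omega_C2 bx neg.
have [_ g2 _] := ch.
have xl := @path_at_left i t t0 tT; have Fl := @force_at_left i t t0 tT.
have HF : \forall s \near t^'-, H i s = F i (s, X s).
  have gs : \forall s \near t^'-, 0 < dgap Q gamma (row i (X s)) (F i (s, X s)).
    exact: (cvgr_gt _ (cvg_dgap (C2_C1 g2) xl Fl) _ gF).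
  have chs : \forall s \near t^'-, C2_chart Omega (row i (X s)) Q gamma.
    exact: xl _ (C2_chart_near ch).
  apply: filterS2 gs chs => s {}gs {}chs.
  by apply: proj_id => bs; exact: (outward_normal_le0 oO Omega_C2 chs bs gs).
have : dot (- F i (t, X t)) (outward_unit_normal Omega (row i (X t))) <= 0.
  apply: (inward_velocity oO Omega_C2 bx (path_rderiv_left t0 tT HF)); near=> h.
  apply: config_in_G; apply/andP; split.
    by rewrite subr_ge0; near: h; exact: nbhs_right_ltW.
  by apply: le_trans tT; rewrite gerBl; near: h; exact: nbhs_right_ge.
by rewrite dotNl oppr_le0 leNgt neg.
Unshelve. all: by end_near. Qed.

End mild.

Theorem proposition2p14 (R : realType) (m n : nat)
    (Omega : set 'rV[R]_m.+1) (T : R) (X0 : 'M[R]_(n, m.+1))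
    (F : 'I_n -> R * 'M[R]_(n, m.+1) -> 'rV[R]_m.+1)
    (X : R -> 'M[R]_(n, m.+1))
    (Omega_dom : bounded_domain Omega)
    (Omega_C2 : C2_boundary Omega)
    (n_ge1 : (1 <= n)%N)
    (T_gt0 : 0 < T)
    (X0_G : conf_space Omega X0)
    (F_cont : forall i, {within `[0, T] `*` conf_space Omega, continuous (F i)})
    (X_mild : mild_solution Omega T X0 F X)
    (i : 'I_n) (t0 : R) (t0_in : 0 < t0 <= T)
    (x_bd : boundary Omega (row i (X t0))) :
  0 <= dot (F i (t0, X t0)) (outward_unit_normal Omega (row i (X t0)))
  /\
  ((exists delta : R, [/\ 0 < delta, t0 + delta <= T &
      forall t, t0 < t < t0 + delta -> Omega (row i (X t))]) ->
   ((fun tau : R => tau^-1 *: (row i (X (t0 + tau)) - row i (X t0)))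
      @ 0^'+ --> F i (t0, X t0))
   /\ dot (F i (t0, X t0)) (outward_unit_normal Omega (row i (X t0))) = 0).

Proof.
have [_ oO _ _] := Omega_dom; move: t0_in => /andP[t00 t0T].
have out := force_outward F_cont X_mild Omega_C2 oO t00 t0T x_bd.
split=> // -[d [d0 dT inO]].
have t0ltT : t0 < T by apply: lt_le_trans dT; rewrite ltrDl.
have near_in : \forall s \near t0^'+, Omega (row i (X s)).
  near=> s; apply: inO; apply/andP; split; near: s; first exact: nbhs_right_gt.
  by apply: nbhs_right_lt; rewrite ltrDl.
have vel : rderiv (fun h => row i (X (t0 + h))) (row i (X t0)) (F i (t0, X t0)).
  apply: (path_rderiv_right F_cont X_mild Omega_C2 (ltW t00) t0ltT).
  apply: filterS near_in => s Os; apply: proj_id => -[_ []].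
  exact: open_nbhs_nbhs.
split; first exact: vel.
apply/eqP; rewrite eq_le out andbT.
apply: (inward_velocity oO Omega_C2 x_bd vel); near=> h.
apply: subset_closure; apply: inO; apply/andP; split.
  by rewrite ltrDl; near: h; exact: nbhs_right_gt.
by rewrite ltrD2l; near: h; exact: nbhs_right_lt.
Unshelve. all: by end_near. Qed.
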